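(* Let $p$ be a prime, let $q=p^n$ with $n\ge 1$, and let $D \subset \mathbb{F}_q^*$. Suppose $f:\mathbb{F}_q \to \mathbb{F}_q$ is a function such that $$\frac{f(x)-f(y)}{x-y} \in D$$ whenever $x,y \in \mathbb{F}_q$ with $x \neq y$. If $$|DD^{-1}D^{-1}|\leq \frac{q+1}{2},$$ then there are $a,b \in \mathbb{F}_q$ and an integer $0 \leq j \leq n-1$ such that $f(x)=a x^{p^j}+b$ for all $x \in \mathbb{F}_q$. In particular, if $c>0$ is a real number such that $|DD|\leq c|D|$ and $c^3|D|\leq \frac{q+1}{2}$, then the same conclusion holds (that is, there are $a,b \in \mathbb{F}_q$ and an integer $0 \leq j \leq n-1$ such that $f(x)=a x^{p^j}+b$ for all $x \in \mathbb{F}_q$).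
   Context: $\mathbb{F}_q$ denotes the finite field with $q$ elements and $\mathbb{F}_q^*=\mathbb{F}_q\setminus\{0\}$. For subsets $A,B\subset \mathbb{F}_q^*$, write $AB=\{ab: a\in A, b\in B\}$ and $A^{-1}=\{a^{-1}: a\in A\}$; thus $DD^{-1}D^{-1}=\{d_1d_2^{-1}d_3^{-1}: d_1,d_2,d_3\in D\}$ and $DD=\{d_1d_2: d_1,d_2\in D\}$. *)

(* Defs.v *)
From HB Require Import structures.
From mathcomp Require Import all_boot all_order all_algebra.
From mathcomp Require Import reals.

Set Implicit Arguments.
Unset Strict Implicit.
Unset Printing Implicit Defensive.

Import GRing.Theory.
Local Open Scope ring_scope.

Definition prod_set (F : finFieldType) (A B : {set F}) : {set F} :=
  [set a * b | a in A, b in B].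

(* Only meant for sets avoiding 0, since MathComp has 0^-1 = 0. *)
Definition inv_set (F : finFieldType) (A : {set F}) : {set F} :=
  [set a^-1 | a in A].

Definition affine_frobenius_monomial (F : finFieldType) (p n : nat) (f : F -> F) : Prop :=
  exists (a b : F) (j : nat),
    (j <= n - 1)%N /\ forall x : F, f x = a * x ^+ (p ^ j) + b.

(* Main.v *)
(* Let E = D D^-1 D^-1. If f has slopes in D and f(0) = 0, then
   g(x) = 1 / f(1/x) has slopes in E. A function whose nonzero slopes number at
   most (q+1)/2 is a polynomial of degree at most q/2, so f and g are both of low
   degree, and f(1/x) g(x) = 1 on F^* becomes a formal identity forcing
   f = c X^M. The same applies to f(x+1) - f(1), whence (X+1)^M = X^M + 1 and M is
   a power of p.

   For the degree bound, expand R(T,Z) = prod_x (T - x + Z f(x)). The coefficient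
   of T^i is a polynomial in Z of degree less than q - i that vanishes whenever
   x - z f(x) is a permutation, that is, for every z outside D^-1; hence it is
   zero for q/2 < i < q. But the coefficient of Z in R is, up to a scalar, the
   polynomial interpolating f.

   The doubling hypothesis is reduced to the first one by the Plunnecke-Ruzsa
   inequality |A (AA)^-1| |A|^2 <= |AA|^3. *)

Require Import Defs.
From HB Require Import structures.
From mathcomp Require Import all_boot all_order all_algebra.
From mathcomp Require Import all_fingroup all_field zify ring.
From mathcomp Require Import reals.

Set Implicit Arguments.
Unset Strict Implicit.
Unset Printing Implicit Defensive.

Import Order.TTheory GRing.Theory Num.Theory.
Local Open Scope ring_scope.

(** * Growth of product sets in finite groups *)

Section SumsetGrowth.

Local Open Scope nat_scope.
Local Open Scope group_scope.

Variable gT : finGroupType.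
Implicit Types A B C V W X Z : {set gT}.

(** [X] minimises the ratio of [#|X * A|] to [#|X|] over nonempty subsets of [A]; cross-multiplying
    also covers empty [Z]. *)
Lemma exists_min_expansion A : A != set0 ->
  exists X, [/\ X != set0, X \subset A &
    forall Z, Z \subset A -> #|X * A| * #|Z| <= #|Z * A| * #|X| ].
Proof.
move=> A0; pose P X := (X != set0) && (X \subset A).
pose r X : rat := (#|(X * A)%g|%:R / #|X|%:R)%R.
have PA : P A by rewrite /P A0 /=.
case: (arg_minP r PA) => X /andP[X0 XA] Xmin.
exists X; split=> // Z ZA.
have [-> | Z0] := eqVneq Z set0; first by rewrite cards0 muln0.
have := Xmin Z; rewrite /P Z0 ZA => /(_ isT).
rewrite /r ler_pdivrMr ?ltr0n ?card_gt0 // mulrAC.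
by rewrite ler_pdivlMr ?ltr0n ?card_gt0 // -!natrM ler_nat.
Qed.

(* Petridis' lemma, by induction on [C]: adding [g] to [C] adds to [C * X * A]
   at most [g * (X \ Z) * A] with [Z] the part of [X] already accounted for, and
   minimality of [X] bounds [Z * A] from below. *)
Lemma petridis A X C :
    (forall Z, Z \subset X -> #|X * A| * #|Z| <= #|Z * A| * #|X|) ->
  #|C * X * A| * #|X| <= #|X * A| * #|C * X|.
Proof.
move=> Xmin; have [m] := ubnP #|C|; elim: m C => // m IHm C ltCm.
have [-> | [g Cg]] := set_0Vmem C; first by rewrite !mul0g cards0.
have : #|C :\ g| < m by rewrite (cardsD1 g C) Cg in ltCm.
move/IHm=> {IHm}; set C0 := C :\ g => IH; rewrite -(setD1K Cg) -/C0.
have cardg B : #|[set g] * B| = #|B| by apply: card_lcoset.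
pose Z := [set x in X | [set g] * ([set x] * A) \subset C0 * X * A].
have ZX : Z \subset X by apply/subsetP=> x; rewrite inE => /andP[].
have gZA : [set g] * (Z * A) \subset (C0 * X * A) :&: ([set g] * (X * A)).
  rewrite subsetI mulgS ?mulSg // andbT.
  apply/subsetP=> _ /mulsgP[_ _ /set1P-> /mulsgP[x a Zx Aa ->] ->].
  move: Zx; rewrite inE => /andP[_ /subsetP]; apply.
  by rewrite !mem_mulg ?set11.
(* If [g * x] lies in [C0 * X], then [g * x * A] lies in [C0 * X * A], so [x] is in [Z]. *)
have gX : (C0 * X) :&: ([set g] * X) \subset [set g] * Z.
  apply/subsetP=> y /setIP[C0Xgx /mulsgP[_ x /set1P-> Xx def_y]].
  rewrite def_y in C0Xgx *; rewrite mem_mulg ?set11 // inE Xx mulgA mulSg //.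
  by rewrite mulg_set1 sub1set.
have := cardsUI (C0 * X * A) ([set g] * (X * A)).
have := cardsUI (C0 * X) ([set g] * X).
move/subset_leq_card: gZA; move/subset_leq_card: gX.
have := Xmin Z ZX; move: IH.
rewrite !mulUg -!mulgA !cardg !(setUC ([set g] * _)).
set i := #|_ :&: _|; set k := #|X * A|; set z := #|Z|; set u := #|Z * A|.
move=> p0 minZ iz.
set l := #|_ :&: _| => ul cX cXA.
have : u * #|X| <= l * #|X| by rewrite leq_mul2r ul orbT.
have : k * i <= k * z by rewrite leq_mul2l iz orbT.
move/(congr1 (muln k)): cX; move/(congr1 (muln^~ #|X|)): cXA => /=.
rewrite !mulnDl !mulnDr; move: p0 minZ.
set a := #|_ :|: _|; set b := #|_ :|: _|; set x := #|X|.
set c := #|_|; set d := #|_|; lia.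
Qed.

(* Ruzsa's triangle inequality: [(v * w^-1, x)] is recovered from
   [(v * x, w * x)] once a representation [v * w^-1] is fixed. *)
Lemma ruzsa_triangle V W X :
  #|V * W^-1| * #|X| <= #|V * X| * #|W * X|.
Proof.
pose v y := odflt 1 [pick v in V | y^-1 * v \in W].
have vP y : y \in V * W^-1 -> v y \in V /\ y^-1 * v y \in W.
  case/mulsgP=> a b Va Wb ->; rewrite /v; case: pickP => [c /andP[] // | no_v].
  by have := no_v a; rewrite Va invMg mulgKV -mem_invg Wb.
pose h (yx : gT * gT) := (v yx.1 * yx.2, yx.1^-1 * v yx.1 * yx.2).
have h_inj : injective h.
  move=> [y x] [y' x'] [/= e1 e2].
  have ey : y = y'.
    by apply: invg_inj; apply: (mulIg (v y * x)); rewrite [in RHS]e1 !mulgA.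
  by move: e1; rewrite ey => /mulgI ->.
rewrite -!cardsX -(card_imset _ h_inj) subset_leq_card //.
apply/subsetP=> _ /imsetP[[y x] /setXP[/vP[Vv Wv] Xx] ->].
by rewrite inE /= !mem_mulg.
Qed.

Lemma plunnecke_ruzsa A : abelian A ->
  #|A * (A * A)^-1| * #|A| ^ 2 <= #|A * A| ^ 3.
Proof.
move=> cAA; have [-> | A0] := eqVneq A set0; first by rewrite mul0g cards0.
have [X [X0 XA Xmin]] := exists_min_expansion A0.
have cAX : A * X = X * A.
  by apply/normC/cents_norm; apply: subset_trans cAA (centS XA).
have minA := Xmin A (subxx A).
have := ruzsa_triangle A (A * A) X.
have := petridis A (fun Z ZX => Xmin Z (subset_trans ZX XA)).
rewrite -!mulgA cAX.
move: minA (subset_leq_card XA); rewrite -card_gt0 in X0.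
set e := #|A * _^-1|; set w := #|A * (X * A)|; set t := #|A * A|.
set u := #|X * A|; set x := #|X| in X0 *; set a := #|A|.
(* The triangle inequality and Petridis' lemma give [e * x ^ 2 <= u ^ 3]; minimality against [A]
   itself gives [u * a <= t * x]. Eliminate [u], then use [x <= a]. *)
move=> minA le_xa le_w le_e.
have {}minA : (u * a) ^ 3 <= (t * x) ^ 3 by rewrite leq_exp2r.
have {le_w}le_e : e * x ^ 2 <= u ^ 3.
  rewrite (leq_trans (n := u * w * x)) //.
    by rewrite mulnA leq_mul2r le_e orbT.
  by rewrite -mulnA leq_mul2l le_w orbT.
have e3 : (e * a ^ 3) * x ^ 2 <= (t ^ 3 * x) * x ^ 2.
  rewrite -[leqRHS]mulnA -expnS -expnMn (leq_trans _ minA) // expnMn mulnAC.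
  by rewrite leq_mul2r le_e orbT.
rewrite leq_pmul2r ?expn_gt0 ?X0 // in e3.
rewrite -(leq_pmul2r (leq_trans X0 le_xa)) -mulnA -expnSr [leqRHS]mulnC.
rewrite (leq_trans e3) //.
by rewrite mulnC leq_mul2r le_xa orbT.
Qed.

End SumsetGrowth.

(** * From the unit group to subsets of the field *)

Section Transfer.

Variable F : finFieldType.
Implicit Types (A B D : {set F}) (U V : {set {unit F}}).

Lemma val_mulg_set U V :
  val @: (U * V)%g = prod_set (val @: U) (val @: V).
Proof.
apply/setP=> x; apply/imsetP/imset2P.
  move=> [_ /mulsgP[u v Uu Vv ->] ->].
  by exists (val u) (val v); rewrite ?imset_f ?FinRing.val_unitM.
move=> [_ _ /imsetP[u Uu ->] /imsetP[v Vv ->] ->].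
by exists (u * v)%g; rewrite ?mem_mulg ?FinRing.val_unitM.
Qed.

Lemma val_invg_set U : val @: U^-1%g = inv_set (val @: U).
Proof.
apply/setP=> x; apply/imsetP/imsetP.
  move=> [u Uu ->]; exists (val u^-1%g); first by rewrite imset_f -?mem_invg.
  by rewrite FinRing.val_unitV invrK.
move=> [_ /imsetP[u Uu ->] ->].
by exists u^-1%g; rewrite ?memV_invg ?FinRing.val_unitV.
Qed.

Lemma val_unit_set D : 0 \notin D ->
  val @: [set u : {unit F} | val u \in D] = D.
Proof.
move=> D0; apply/setP=> x; apply/imsetP/idP => [[u] | Dx].
  by rewrite inE => Du ->.
have Ux : x \is a GRing.unit by rewrite unitfE; apply: contraNneq D0 => <-.
by exists (FinRing.unit F Ux); rewrite ?inE.
Qed.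

Lemma card_prod_set_inv_inv D : 0 \notin D ->
  (#|prod_set (prod_set D (inv_set D)) (inv_set D)| * #|D| ^ 2
     <= #|prod_set D D| ^ 3)%N.
Proof.
move=> /val_unit_set <-; set U := [set u | _].
rewrite -val_invg_set -!val_mulg_set !card_imset; try exact: val_inj.
rewrite -mulgA -invMg plunnecke_ruzsa //.
by apply/centsP=> u _ v _; apply: val_inj; rewrite !FinRing.val_unitM mulrC.
Qed.

End Transfer.

(** * Coefficients of products of linear forms in two variables *)

Section ProdLinear.

Variables (R : comNzRingType) (I : Type) (a b : I -> R).

(** The outer ['X] plays the role of [T], the inner one that of [Z]. *)
Let P (r : seq I) : {poly {poly R}} :=
  \prod_(s <- r) ('X + ((a s)%:P + b s *: 'X)%:P).

Let coefP s r i k : (P (s :: r))`_i`_k =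
  (if i is j.+1 then (P r)`_j`_k else 0) + (a s * (P r)`_i`_k +
    b s * (if k is l.+1 then (P r)`_i`_l else 0)).
Proof.
rewrite /P big_cons !mulrDl !coefD coefXM coefCM mulrDl -scalerAl.
by rewrite coefD coefCM coefZ coefXM; case: i k => [|i] [|k] //=; rewrite coef0.
Qed.

(** Each factor has total degree 1 in [T] and [Z]. *)
Lemma coef_prod_linear_gt r i k : (size r < i + k)%N -> (P r)`_i`_k = 0.
Proof.
elim: r i k => [|s r IHr] i k lt_r.
  by rewrite /P big_nil coef1; case: i k lt_r => [|i] [|k]; rewrite ?coef1 ?coef0.
rewrite coefP IHr ?mulr0 ?add0r; last by move: lt_r => /=; lia.
case: i k lt_r => [|i] [|k] /= lt_r; rewrite ?IHr ?mulr0 ?addr0 //; lia.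
Qed.

(** The constants [a s] do not reach the part of top total degree, which is homogeneous, so [Z] may
    be set to 1 there. *)
Lemma coef_prod_linear_eq r i k : (i + k = size r)%N ->
  (P r)`_i`_k = (\prod_(s <- r) ('X + (b s)%:P))`_i.
Proof.
elim: r i k => [|s r IHr] i k eq_r.
  by rewrite /P !big_nil !coef1; case: i k eq_r => [|i] [|k]; rewrite ?coef1 ?coef0.
rewrite coefP coef_prod_linear_gt; last by rewrite eq_r.
rewrite mulr0 add0r big_cons mulrDl coefD coefXM coefCM.
case: i k eq_r => [|i] [|k] /= eq_r.
- by [].
- by rewrite (IHr 0 k) //; lia.
- rewrite (IHr i 0%N) ?(@nth_default _ _ _ i.+1) //; last by lia.
  under eq_bigr do rewrite -[(b _)%:P]opprK -polyCN.
  by rewrite size_prod_XsubC; lia.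
- by rewrite (IHr i k.+1) ?(IHr i.+1 k) //; lia.
Qed.

End ProdLinear.

(** * Degree bound for functions with few slopes *)

Section SlopeBound.

Variable F : finFieldType.
Local Notation q := #|F|.

Lemma prod_XsubC_inj (h : F -> F) : injective h ->
  \prod_x ('X - (h x)%:P) = 'X^q - 'X.
Proof. by move=> h_inj; rewrite finField_genPoly [RHS](reindex_inj h_inj). Qed.

Lemma coef_genPoly i : (1 < i < q)%N -> ('X^q - 'X : {poly F})`_i = 0.
Proof.
case/andP=> lt1i ltiq; rewrite coefB coefXn coefX.
by rewrite (ltn_eqF ltiq) (gtn_eqF lt1i) subr0.
Qed.

Lemma poly_eq_horner (P Q : {poly F}) :
  (size P <= q)%N -> (size Q <= q)%N -> (forall x, P.[x] = Q.[x]) -> P = Q.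
Proof.
move=> szP szQ eqPQ; apply/eqP; rewrite -subr_eq0; apply/eqP.
apply/(@roots_geq_poly_eq0 _ _ (enum F)); rewrite ?enum_uniq //.
  by apply/allP=> x _; rewrite rootE !hornerE eqPQ subrr.
by rewrite -cardE (leq_trans (size_polyD _ _)) // geq_max size_polyN szP.
Qed.

Variables (D : {set F}) (f : F -> F).
Hypothesis D_nz : 0 \notin D.
Hypothesis slopes : forall x y, x != y -> (f x - f y) / (x - y) \in D.

Lemma slopes_inj : injective f.
Proof.
move=> x y eq_fxy; apply: contraNeq D_nz => /slopes.
by rewrite eq_fxy subrr mul0r.
Qed.

(** A collision at [x != y] would make [z] the inverse of the slope between [x] and [y]. *)
Lemma shear_inj z : z \notin inv_set D -> injective (fun x => x - z * f x).
Proof.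
move=> Dz x y eq_xy; apply: contraNeq Dz => neq_xy.
have fxy0 : f x - f y != 0 by rewrite subr_eq0 (inj_eq slopes_inj).
apply/imsetP; exists ((f x - f y) / (x - y)); first exact: slopes.
apply: (mulIf fxy0); rewrite invf_div divfK //.
have -> : z * (f x - f y) = x - y + (y - z * f y - (x - z * f x)) by ring.
by rewrite eq_xy subrr addr0.
Qed.

Lemma slopes_low_degree : (#|D|.*2 <= q.+1)%N ->
  exists2 P : {poly F}, (size P <= q./2.+1)%N & forall x, f x = P.[x].
Proof.
move=> leD.
pose R : {poly {poly F}} := \prod_(x <- enum F) ('X + ((- x)%:P + f x *: 'X)%:P).
have szF : size (enum F) = q by rewrite -cardE.
have R0 i : (q./2 < i < q)%N -> R`_i = 0.
  case/andP=> lt_i ltiq; have gt1q : (1 < q)%N := finNzRing_gt1 F.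
  have Ri_good z : z \notin inv_set D -> root R`_i z.
    move=> Dz; rewrite rootE -[_.[z]]/(horner_eval z _) -coef_map.
    rewrite /R rmorph_prod /= big_enum /=.
    rewrite (eq_bigr (fun x => 'X - (x - z * f x)%:P)) => [|x _].
      by rewrite (prod_XsubC_inj (shear_inj Dz)) coef_genPoly //; lia.
    rewrite rmorphD /= map_polyX map_polyC /= /horner_eval !hornerE -polyCN.
    by congr ('X + _%:P); ring.
  apply/(@roots_geq_poly_eq0 _ _ (enum (~: inv_set D))).
  - by apply/allP=> z; rewrite mem_enum inE => /Ri_good.
  - exact: enum_uniq.
  rewrite -cardE cardsCs setCK.
  have leD' : (#|inv_set D| <= #|D|)%N by apply: leq_imset_card.
  (* Since [#|D| <= (q + 1) / 2 <= i], at least [q - i] roots are available. *)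
  suff szRi : (size (R`_i)%R <= q - i)%N.
    apply: leq_trans szRi (leq_sub2l _ (leq_trans leD' _)).
    by rewrite -leq_double (leq_trans leD) //; lia.
  apply/leq_sizeP=> k le_k; have [lt_k | eq_k] := ltnP (q - i) k.
    by apply: coef_prod_linear_gt; rewrite szF; lia.
  (* In the borderline case [k = q - i] the coefficient is that of [T^i] in the product of the
     [T + f x], which is [T^q - T] because [f] permutes the field. *)
  rewrite coef_prod_linear_eq ?szF; last by lia.
  rewrite big_enum /= (eq_bigr (fun x => 'X - (- f x)%:P)) => [|x _].
    rewrite prod_XsubC_inj ?coef_genPoly //; first by lia.
    by move=> x y /oppr_inj /slopes_inj.
  by rewrite polyCN opprK.
pose k : F := \prod_(u | u != 0) u.
have k0 : k != 0 by apply/prodf_neq0.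
have Rgt i : (q <= i)%N -> (R`_i)`_1 = 0.
  by move=> leqi; apply: coef_prod_linear_gt; rewrite szF addn1.
have szR : (size R <= q.+1)%N.
  apply/leq_sizeP=> i lti; apply/polyP=> j; rewrite coef0.
  by apply: coef_prod_linear_gt; rewrite szF; lia.
(* The coefficient of [Z] in [R] is the sum over [x] of [f x] times the product of [T - y] for
   [y != x]: Lagrange interpolation scaled by [k]. *)
pose P := \poly_(i < q.+1) (R`_i)`_1.
have szP : (size P <= q./2.+1)%N.
  apply/leq_sizeP=> i lti; rewrite coef_poly; case: ifP => // _.
  by have [/Rgt | ltiq] := leqP q i; last by rewrite R0 ?coef0 // lti.
exists (k^-1 *: P) => [|t]; first exact: leq_trans (size_scale_leq _ _) szP.
have kE : \prod_(x | x != t) (t - x) = k.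
  rewrite (reindex_inj (subrI t)); apply: eq_big => [u | u _].
    by rewrite -subr_eq0 addrAC subrr sub0r oppr_eq0.
  by rewrite subKr.
have RtE : (R.[t%:P])`_1 = f t * k.
  rewrite horner_prod big_enum /= (bigD1 t) //= hornerD hornerX hornerC.
  rewrite polyCN addrA subrr add0r.
  rewrite -scalerAl coefZ coefXM /= -horner_coef0 horner_prod -kE.
  congr (_ * _); apply: eq_bigr => x _.
  by rewrite !hornerE /= addr0.
rewrite hornerZ horner_poly; apply: (mulIf k0).
rewrite -RtE [RHS]mulrC mulVKf // (horner_coef_wide _ szR) coef_sum.
by apply: eq_bigr => i _; rewrite -rmorphXn coefMC.
Qed.

End SlopeBound.

(** * Inversion and reduction to monomials *)

Section LowDegreeInversion.

Variable F : finFieldType.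
Local Notation q := #|F|.

(* Both sides of [rev P * G = 'X^M] have degree less than [q], so the identity
   [P.[x^-1] * G.[x] = 1] holds formally; as [rev P] does not vanish at 0, it is
   constant. *)
Lemma low_degree_inv_monomial (P G : {poly F}) :
    (size P <= q./2.+1)%N -> (size G <= q./2.+1)%N ->
    P.[0] = 0 -> G.[0] = 0 -> (forall x, x != 0 -> P.[x^-1] * G.[x] = 1) ->
  exists c M, [/\ c != 0, (0 < M <= q./2)%N & P = c *: 'X^M].
Proof.
move=> szP szG P0 G0 PG; have gt1q : (1 < q)%N := finNzRing_gt1 F.
have nzP : P != 0.
  apply: contraTneq (oner_neq0 F) => P_0.
  by rewrite -(PG 1) ?oner_neq0 // P_0 horner0 mul0r eqxx.
have [M szPM] : exists M, size P = M.+1.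
  by exists (size P).-1; rewrite prednK // size_poly_gt0.
have nzPM : P`_M != 0 by rewrite -[M]/(M.+1.-1) -szPM -lead_coefE lead_coef_eq0.
have P_0 : P`_0 = 0 by rewrite -horner_coef0.
have gt0M : (0 < M)%N by case: (M) nzPM P_0 => // /eqP.
pose Q := \poly_(i < M.+1) P`_(M - i).
have Q_0 : Q`_0 = P`_M by rewrite coef_poly subn0.
(* The zero constant term of [P] saves one degree; for even [q] this is what keeps the size of
   [Q * G] within [q]. *)
have szQ : (size Q <= M)%N.
  apply/leq_sizeP=> i le_i; rewrite coef_poly ltnS; case: ifP => // le_iM.
  by have /eqP-> : (M - i)%N == 0%N by lia.
have QE x : x != 0 -> Q.[x] = x ^+ M * P.[x^-1].
  move=> nzx; rewrite horner_poly (@horner_coef_wide _ M.+1) ?szPM // mulr_sumr.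
  rewrite (reindex_inj rev_ord_inj); apply: eq_bigr => -[i /= lti] _.
  rewrite subSS subKn // exprB ?unitfE // exprVn mulrCA; congr (_ * _).
have QG : Q * G = 'X^M.
  apply: poly_eq_horner => [||x].
  - by rewrite (leq_trans (size_polyMleq _ _)) //; lia.
  - by rewrite size_polyXn; lia.
  rewrite hornerM hornerXn; have [-> | nzx] := eqVneq x 0.
    by rewrite G0 mulr0 expr0n gtn_eqF.
  by rewrite QE // -mulrA PG ?mulr1.
have szQ1 : size Q = 1%N.
  have : Q %| ('X - 0%:P) ^+ M by rewrite subr0 -QG dvdp_mulIl.
  case/dvdp_exp_XsubCP=> -[|k] _; first by rewrite -size_poly_eq1 => /eqP.
  move/eqp_root/(_ 0); rewrite root_exp_XsubC eqxx rootE horner_coef0 Q_0.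
  by rewrite (negPf nzPM).
exists P`_M, M; split=> //; first by lia.
apply/polyP=> i; rewrite coefZ coefXn.
have [-> | neq_iM] := eqVneq i M; rewrite ?mulr1 // mulr0.
have [le_i | lt_i] := leqP (size P) i; first exact: nth_default.
have : Q`_(M - i) = 0 by rewrite nth_default // szQ1; lia.
by rewrite coef_poly ltnS leq_subr subKn // -ltnS -szPM.
Qed.

Variables (D : {set F}) (f : F -> F).
Hypothesis D_nz : 0 \notin D.
Hypothesis slopes : forall x y, x != y -> (f x - f y) / (x - y) \in D.

Local Notation E := (prod_set (prod_set D (inv_set D)) (inv_set D)).

Lemma prod_set_inv_inv_neq0 : 0 \notin E.
Proof.
apply/imset2P=> -[_ _ /imset2P[d1 _ D1 /imsetP[d2 D2 ->] ->] /imsetP[d3 D3 ->]].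
move/esym/eqP; rewrite !mulf_eq0 !invr_eq0.
by rewrite !(negPf (memPn D_nz _ _)).
Qed.

(** Dividing twice by a fixed [d] in [D] embeds [D] in [E]. *)
Lemma leq_card_prod_set_inv_inv : (#|D| <= #|E|)%N.
Proof.
have [-> | [d Dd]] := set_0Vmem D; first by rewrite cards0.
have nzd : d != 0 by apply: contraNneq D_nz => <-.
rewrite -(card_imset (mem D) (mulIf (invr_neq0 (mulf_neq0 nzd nzd)))).
apply/subset_leq_card/subsetP=> _ /imsetP[x Dx ->].
rewrite invfM mulrA; apply/imset2P; exists (x / d) d^-1 => //.
  by apply/imset2P; exists x d^-1; rewrite ?imset_f.
by rewrite imset_f.
Qed.

(** For nonzero [x], [y], a slope of [g] is a slope of [f] between the inverses, divided by the two
    slopes joining them to the origin. *)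
Lemma inv_slopes : f 0 = 0 -> let g x := (f x^-1)^-1 in
  forall x y, x != y -> (g x - g y) / (x - y) \in E.
Proof.
move=> f0 g.
have fD x : x != 0 -> f x / x \in D.
  by move/slopes; rewrite f0 !subr0.
have f_neq0 x : x != 0 -> f x != 0.
  by rewrite -[X in f x != X]f0 (inj_eq (slopes_inj D_nz slopes)).
have memE a b c : a \in D -> b \in D -> c \in D -> a / b / c \in E.
  by move=> Da Db Dc; apply: imset2_f; rewrite ?imset2_f ?imset_f.
have g0 : g 0 = 0 by rewrite /g invr0 f0 invr0.
have g0E x : x != 0 -> g x / x \in E.
  move=> nzx; have Dx := fD x^-1 (invr_neq0 nzx).
  (* The slope of [g] from the origin is the inverse of a slope [s] of [f], written [s / s / s] to
     land in [E]. *)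
  rewrite (_ : _ / _ = f x^-1 / x^-1 / (f x^-1 / x^-1) / (f x^-1 / x^-1)) ?memE //.
  by rewrite /g; field; rewrite nzx oner_neq0 f_neq0 ?invr_neq0.
move=> x y neq_xy; have [x0 | nzx] := eqVneq x 0.
  by rewrite x0 g0 !sub0r invrN mulrNN g0E // -x0 eq_sym.
have [y0 | nzy] := eqVneq y 0; first by rewrite y0 g0 !subr0 g0E.
have [nzx' nzy'] : x^-1 != 0 /\ y^-1 != 0 by rewrite !invr_neq0.
have neq_yx' : y^-1 != x^-1 by rewrite (inj_eq invr_inj) eq_sym.
pose dyx := (f y^-1 - f x^-1) / (y^-1 - x^-1).
rewrite (_ : _ / _ = dyx / (f x^-1 / x^-1) / (f y^-1 / y^-1)).
  by rewrite memE ?fD ?slopes.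
by rewrite /g /dyx; field; rewrite nzx nzy oner_neq0 !f_neq0 // mulN1r subr_eq0.
Qed.

Lemma slopes_monomial : f 0 = 0 -> (#|E|.*2 <= q.+1)%N ->
  exists c M, [/\ c != 0, (0 < M <= q./2)%N & forall x, f x = c * x ^+ M].
Proof.
move=> f0 leE; pose g x := (f x^-1)^-1.
have [|P szP fE] := slopes_low_degree D_nz slopes.
  by rewrite (leq_trans _ leE) // leq_double leq_card_prod_set_inv_inv.
have [G szG gE] := slopes_low_degree prod_set_inv_inv_neq0 (inv_slopes f0) leE.
have [|||c [M [nzc M_bound PE]]] := low_degree_inv_monomial szP szG.
- by rewrite -fE.
- by rewrite -gE invr0 f0 invr0.
- move=> x nzx; rewrite -fE -gE divff //.
  by rewrite -f0 (inj_eq (slopes_inj D_nz slopes)) invr_eq0.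
by exists c, M; split=> // x; rewrite fE PE hornerZ hornerXn.
Qed.

End LowDegreeInversion.

(** Write [M = m * k] with [k] the [p]-part. By Frobenius the identity for [M] is the one for [m]
    composed with ['X^k], so it holds for [m]. If [m > 1], derivatives at 0 give [m = 0] in [F],
    although [p] does not divide [m]. *)
Lemma additive_monomial_exponent (F : fieldType) (p M : nat) :
    p \in [pchar F] -> (0 < M)%N -> ('X + 1) ^+ M = 'X^M + 1 :> {poly F} ->
  exists j, M = (p ^ j)%N.
Proof.
move=> charFp gt0M XM; have p_pr := pcharf_prime charFp.
have [m p'm defM] := pfactor_coprime p_pr gt0M.
set k := (p ^ _)%N in defM; exists (logn p M); rewrite -/k.
have kp : [pchar {poly F}].-nat k by rewrite pnatX pnatE // pchar_poly charFp.
have gt0k : (0 < k)%N by rewrite expn_gt0 prime_gt0.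
have Xm : ('X + 1) ^+ m = 'X^m + 1 :> {poly F}.
  apply/eqP; rewrite -subr_eq0 -(@comp_poly_eq0 _ _ 'X^k) ?size_polyXn //.
  rewrite comp_polyB rmorphXn /= !comp_polyD comp_polyX rmorph1 comp_Xn_poly.
  rewrite subr_eq0 -[X in _ + X](expr1n _ k) -exprDn_pchar // -!exprM.
  by rewrite mulnC -defM XM.
have [m_le1 | gt1m] := leqP m 1.
  by move: gt0M; rewrite defM; case: m m_le1 {defM p'm Xm} => [|[]] //; rewrite mul1n.
have := congr1 (fun P => P^`().[0]) Xm.
rewrite deriv_exp !derivE !addr0 mul1r !hornerMn !horner_exp.
rewrite !hornerD hornerX hornerC add0r expr1n expr0n.
move: p'm; rewrite prime_coprime // (dvdn_pcharf charFp) => /eqP.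
by rewrite -subn1 subn_eq0 leqNgt gt1m mul0rn => nz_m /nz_m.
Qed.

(** * Comparison of translates and conclusion *)

Section Main.

Variables (F : finFieldType) (p n : nat) (D : {set F}) (f : F -> F).
Hypotheses (p_prime : prime p) (cardF : #|F| = (p ^ n)%N) (D_nz : 0 \notin D).
Hypothesis slopes : forall x y, x != y -> (f x - f y) / (x - y) \in D.

Lemma slopes_affine_frobenius :
    (#|prod_set (prod_set D (inv_set D)) (inv_set D)|.*2 <= #|F|.+1)%N ->
  affine_frobenius_monomial p n f.
Proof.
move=> leE; have gt1q : (1 < #|F|)%N := finNzRing_gt1 F.
have shift t x y : x != y ->
    (f (x + t) - f t - (f (y + t) - f t)) / (x - y) \in D.
  move=> neq_xy; rewrite (_ : _ / _ = (f (x + t) - f (y + t)) / (x + t - (y + t))).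
    by rewrite slopes // (inj_eq (addIr t)).
  by congr (_ / _); ring.
have monom t := slopes_monomial D_nz (shift t).
have [|c [M [nzc /andP[gt0M leM] fE]]] := monom 0 _ leE.
  by rewrite add0r subrr.
have [|c1 [M1 [nzc1 /andP[gt0M1 leM1] f1E]]] := monom 1 _ leE.
  by rewrite add0r subrr.
have charFp := card_finPcharP cardF p_prime.
have X1E : 'X + 1 = 'X - (- 1)%:P :> {poly F} by rewrite polyCN opprK.
have szXM : size (('X + 1) ^+ M : {poly F}) = M.+1.
  by rewrite X1E size_exp_XsubC.
have XM_M : (('X + 1) ^+ M : {poly F})`_M = 1.
  have /monicP := monic_exp M (monicXsubC (- 1 : F)).
  by rewrite -X1E lead_coefE szXM.
have XME : c *: ('X + 1) ^+ M - c%:P = c1 *: 'X^M1.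
  apply: poly_eq_horner => [||x].
  - rewrite (leq_trans (size_polyD _ _)) // geq_max size_polyN size_polyC.
    rewrite (leq_trans (size_scale_leq _ _)) ?szXM; last by lia.
    by rewrite (leq_trans (leq_b1 _)) //; lia.
  - by rewrite (leq_trans (size_scale_leq _ _)) // size_polyXn; lia.
  rewrite !(hornerE, hornerXn, horner_exp) -f1E.
  have fxE y : f y = c * y ^+ M + f 0 by rewrite -fE addr0 subrK.
  by rewrite (fxE (x + 1)) (fxE 1) expr1n mulr1; ring.
have XMM : ('X + 1) ^+ M = 'X^M + 1 :> {poly F}.
  (* The left side of [XME] has coefficient [c != 0] at degree [M], which forces [M1 = M] and
     [c1 = c]. *)
  have := congr1 (fun P : {poly F} => P`_M) XME.
  rewrite coefB coefC gtn_eqF // subr0 !coefZ coefXn.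
  rewrite XM_M mulr1; case: eqP => [M1E | _]; last first.
    by rewrite mulr0 => c0; rewrite c0 eqxx in nzc.
  rewrite mulr1 => c1c; apply: (scalerI nzc).
  by apply/eqP; rewrite scalerDr alg_polyC -subr_eq XME -M1E -c1c.
have [j defM] := additive_monomial_exponent charFp gt0M XMM.
exists c, (f 0), j; split=> [|x].
  (* [p ^ j = M <= q / 2 < p ^ n] yields [j < n]. *)
  rewrite -ltnS subn1 prednK; last first.
    by case: (n) cardF => // q1; rewrite q1 in gt1q.
  rewrite -(ltn_exp2l _ _ (prime_gt1 p_prime)) -defM -cardF; lia.
by rewrite -defM -fE addr0 subrK.
Qed.

End Main.

Theorem theorem1p2 (p n q : nat) (p_prime : prime p) (n_ge1 : (1 <= n)%N)
    (qE : q = (p ^ n)%N) (F : finFieldType) (cardF : #|F| = q)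
    (D : {set F}) (D_nz : 0 \notin D) (f : F -> F)
    (slopes : forall x y : F, x != y -> (f x - f y) / (x - y) \in D) :
  ((#|prod_set (prod_set D (inv_set D)) (inv_set D)|%:R : rat)
      <= (q%:R + 1) / 2%:R ->
     affine_frobenius_monomial p n f)
  /\
  (forall (R : realType) (c : R),
     0 < c ->
     #|prod_set D D|%:R <= c * #|D|%:R ->
     c ^+ 3 * #|D|%:R <= (q%:R + 1) / 2%:R ->
     affine_frobenius_monomial p n f).
Proof.
have part1 : ((#|prod_set (prod_set D (inv_set D)) (inv_set D)|.*2 <= q.+1)%N ->
    affine_frobenius_monomial p n f).
  by rewrite -cardF; apply: slopes_affine_frobenius; rewrite ?cardF.
have half (K : numFieldType) e : (e%:R : K) <= (q%:R + 1) / 2%:R -> (e.*2 <= q.+1)%N.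
  by rewrite ler_pdivlMr ?ltr0n // -natrM natr1 ler_nat muln2.
split=> [/half/part1 // | R c c_gt0 leDD leD]; apply/part1/(half R).
apply: le_trans leD.
have D_gt0 : 0 < #|D|%:R :> R.
  rewrite ltr0n card_gt0; apply/set0Pn; exists ((f 1 - f 0) / (1 - 0)).
  by rewrite slopes ?oner_neq0.
(* After multiplication by [#|D| ^ 2] the right side is [(c * #|D|) ^ 3], which dominates the cube
   of [#|prod_set D D|]. *)
rewrite -(ler_pM2r (exprn_gt0 2 D_gt0)) -mulrA -exprS -exprMn.
apply: le_trans (lerXn2r 3 _ _ leDD); rewrite ?nnegrE ?ler0n //.
  by rewrite -!natrX -natrM ler_nat card_prod_set_inv_inv.
by rewrite mulr_ge0 // ltW.
Qed.
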